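(* Let $G=(V,E)$ be a finite graph, let $\mathcal{S}=\{S_i\}_{i\in V}$ be a scale on $G$ and let $\overline{\mathcal{S}}=\{\overline{S}_i\}_{i\in V}$ be its dual scale. The mean property A problem (N) at scale $\mathcal{S}$ is dual to the uniform pseudo-flows problem (U) at the dual scale $\overline{\mathcal{S}}$. (N): minimize $\sum_{ij\in E,\,k\in V}c_{ij,k}$ subject to - $n_{i,j}=0$ for each $i\in V$, $j\in V\setminus S_i$; - $\sum_{i\in V,\,j\in S_i}n_{i,j}=|V|$; - $n_{j,k}-n_{i,k}\le c_{ij,k}$ for each $ij\in E$, $k\in V$; - $c_{ij,k},\,n_{i,j}\ge 0$. (U): maximize $|V|\cdot\eta$ subject to - $\varphi_{ij,k}\le\frac{1}{|E|}$ for each $ij\in E$, $k\in V$; - $-\varphi_{ij,k}\le\frac{1}{|E|}$ for each $ij\in E$, $k\in V$; - $\sum_{j\in V,\,ji\in E}\varphi_{ji,k}-\sum_{j\in V,\,ij\in E}\varphi_{ij,k}\ge\eta$ for each $k\in V$, $i\in\overline{S}_k$; - $\eta,\,\varphi_{ij,k}\in\mathbb{R}$.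
   Context: A graph $G=(V,E)$ is oriented, with $E\subset V\times V$ and no self-loops; $ij\in E$ denotes an edge with initial vertex $i$ and terminal vertex $j$. A scale on $G$ is a family $\mathcal{S}=\{S_i\}_{i\in V}$ of subsets of $V$, one per vertex (or an integer $S\ge 0$, with the associated family of closed balls $S_i=B(i,S)$ in the path-length metric). The dual scale is $\overline{\mathcal{S}}=\{\overline{S}_i\}_{i\in V}$ with $\overline{S}_i=\{j\in V: i\in S_j\}$. ''Dual'' is meant in the sense of linear programming duality.
   Formalization: As stated the duality fails (one edge 12, S_i={i}: min 0, max 2). Proved instead: (N) with objective times 2/|E| when in-degree equals out-degree at every vertex; and for all G, (N) with |n_{j,k}-n_{i,k}|≤c_{ij,k} and objective times 1/|E|. *)

(* Defs.v *)
From HB Require Import structures.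
From mathcomp Require Import all_boot all_order all_algebra.
Set Implicit Arguments.
Unset Strict Implicit.
Unset Printing Implicit Defensive.
Import Order.TTheory GRing.Theory Num.Theory.
Local Open Scope ring_scope.

(* A finite linear program in general form.  The rows are                     *)
(*   "<=" rows in a maximization problem (lp_max = true),                     *)
(*   ">=" rows in a minimization problem (lp_max = false),                    *)
(* except for the rows in lp_eq, which are equations; the variables are       *)
(* nonnegative, except for those in lp_free.                                  *)
Record linprog (R : realFieldType) := LP {
  lp_var : finType;
  lp_con : finType;
  lp_max : bool;
  lp_mat : lp_con -> lp_var -> R;
  lp_rhs : lp_con -> R;
  lp_obj : lp_var -> R;
  lp_free : pred lp_var;
  lp_eq : pred lp_con
}.

Section LinearProgramming.
Variable R : realFieldType.
Implicit Types P Q : linprog R.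

Definition lp_row P (r : lp_con P) (x : lp_var P -> R) : R :=
  \sum_v lp_mat r v * x v.

Definition lp_value P (x : lp_var P -> R) : R := \sum_v lp_obj v * x v.

Definition lp_feasible P (x : lp_var P -> R) : Prop :=
  (forall r : lp_con P,
     if lp_eq r then lp_row r x = lp_rhs r
     else if lp_max P then lp_row r x <= lp_rhs r
     else lp_rhs r <= lp_row r x)
  /\ (forall v : lp_var P, ~~ lp_free v -> 0 <= x v).

(* Free variables correspond to equations of the dual, nonnegative variables  *)
(* to inequalities, and conversely.                                           *)
Definition lp_dual P : linprog R :=
  @LP R (lp_con P) (lp_var P) (~~ lp_max P)
    (fun v r => lp_mat r v) (@lp_obj R P) (@lp_rhs R P)
    (@lp_eq R P) (@lp_free R P).

Lemma lp_dualK P : lp_dual (lp_dual P) = P.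
Proof. by case: P => X Y b A c d e f; rewrite /lp_dual /= negbK. Qed.

Definition lp_scale (a : R) P : linprog R :=
  @LP R (lp_var P) (lp_con P) (lp_max P) (@lp_mat R P) (@lp_rhs R P)
    (fun v => a * lp_obj v) (@lp_free R P) (@lp_eq R P).

Definition affine_map (X Y : finType) (f : (X -> R) -> (Y -> R)) : Prop :=
  exists (M : Y -> X -> R) (b : Y -> R),
    forall x y, f x y = \sum_z M y z * x z + b y.

(* P and Q are the same problem up to an affine change of variables and the   *)
(* removal of redundant variables of P (slack variables, a free variable      *)
(* written as a difference of nonnegative ones, variables fixed at 0): the    *)
(* feasible set of Q is an affine retract of that of P, the projection and    *)
(* the section both preserving the objective.                                 *)
Definition lp_reduces P Q : Prop :=
  lp_max P = lp_max Q /\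
  exists (f : (lp_var P -> R) -> (lp_var Q -> R))
         (g : (lp_var Q -> R) -> (lp_var P -> R)),
    [/\ affine_map f /\ affine_map g,
        forall x, lp_feasible x -> lp_feasible (f x) /\
                                   lp_value (f x) = lp_value x,
        forall y, lp_feasible y -> lp_feasible (g y) /\
                                   lp_value (g y) = lp_value y
      & forall y, lp_feasible y -> f (g y) =1 y].

Definition lp_is_dual P Q : Prop :=
  lp_reduces (lp_dual P) Q /\ lp_reduces (lp_dual Q) P.

End LinearProgramming.

Section Graph.
Variables (V : finType) (E : {set V * V}).

Definition loopless : Prop := forall i : V, (i, i) \notin E.

(* Every vertex has as many incoming as outgoing edges; this holds when each  *)
(* edge occurs in both orientations (symmetric_balanced).                     *)
Definition balanced : Prop :=
  forall i : V, #|[set j | (j, i) \in E]| = #|[set j | (i, j) \in E]|.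

Lemma symmetric_balanced :
  (forall i j, ((i, j) \in E) = ((j, i) \in E)) -> balanced.
Proof. by move=> Esym i; apply: eq_card => j; rewrite !inE Esym. Qed.

Definition edge : finType := {e : V * V | e \in E}.
Definition esrc (e : edge) : V := (val e).1.
Definition etgt (e : edge) : V := (val e).2.

Definition dual_scale (S : V -> {set V}) : V -> {set V} :=
  fun i => [set j | i \in S j].

Variable R : realFieldType.

(* Variables: inl (e, k) is c_(e, k) and inr (i, j) is n_(i, j).              *)
Definition N_var : finType := (edge * V + V * V)%type.

(* Rows: n_(i, j) = 0 for j outside of S_i, the normalization, and the        *)
(* inequalities c_(ij, k) - n_(j, k) + n_(i, k) >= 0.                         *)
Definition N_con (S : V -> {set V}) : finType :=
  ({p : V * V | p.2 \notin S p.1} + unit + edge * V)%type.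

Definition N_mat (S : V -> {set V}) (r : N_con S) (v : N_var) : R :=
  match r, v with
  | inl (inl p), inr q => (q == val p)%:R
  | inl (inr _), inr q => (q.2 \in S q.1)%:R
  | inr ek, inl ek' => (ek' == ek)%:R
  | inr ek, inr q => (q == (esrc ek.1, ek.2))%:R - (q == (etgt ek.1, ek.2))%:R
  | _, _ => 0
  end.

Definition N_rhs (S : V -> {set V}) (r : N_con S) : R :=
  if r is inl (inr _) then #|V|%:R else 0.

Definition N_obj (v : N_var) : R := if v is inl _ then 1 else 0.

Definition mean_propA (S : V -> {set V}) : linprog R :=
  @LP R N_var (N_con S) false (@N_mat S) (@N_rhs S) N_obj
    pred0 (fun r => if r is inl _ then true else false).

(* In mean_propA, c_(ij, k) bounds only the positive part of                  *)
(* n_(j, k) - n_(i, k), so the program depends on the orientation of E.       *)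
(* Below is the same program with the additional inequalities                 *)
(* c_(ij, k) - n_(i, k) + n_(j, k) >= 0, so that c_(ij, k) bounds             *)
(* |n_(j, k) - n_(i, k)| and does not depend on the orientation of ij.        *)
Definition abs_N_mat (S : V -> {set V}) (r : N_con S + edge * V) (v : N_var) :
    R :=
  match r, v with
  | inl r', _ => N_mat r' v
  | inr ek, inl ek' => (ek' == ek)%:R
  | inr ek, inr q => (q == (etgt ek.1, ek.2))%:R - (q == (esrc ek.1, ek.2))%:R
  end.

Definition abs_mean_propA (S : V -> {set V}) : linprog R :=
  @LP R N_var (N_con S + edge * V)%type false (@abs_N_mat S)
    (fun r => if r is inl r' then N_rhs r' else 0) N_obj
    pred0 (fun r => if r is inl (inl _) then true else false).

(* Variables: None is eta and Some (e, k) is phi_(e, k).                      *)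
Definition U_var : finType := option (edge * V).

(* Rows: phi_(e, k) <= 1/|E|, - phi_(e, k) <= 1/|E|, and, for i in T_k,       *)
(* eta - (inflow of phi_(-, k) at i) + (outflow of phi_(-, k) at i) <= 0.     *)
Definition U_con (T : V -> {set V}) : finType :=
  (edge * V + edge * V + {p : V * V | p.2 \in T p.1})%type.

Definition U_mat (T : V -> {set V}) (r : U_con T) (v : U_var) : R :=
  match r, v with
  | inl (inl ek), Some ek' => (ek' == ek)%:R
  | inl (inr ek), Some ek' => - (ek' == ek)%:R
  | inr _, None => 1
  | inr p, Some (e, k) =>
      if k == (val p).1
      then (esrc e == (val p).2)%:R - (etgt e == (val p).2)%:R else 0
  | _, _ => 0
  end.

Definition U_rhs (T : V -> {set V}) (r : U_con T) : R :=
  if r is inl _ then #|E|%:R^-1 else 0.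

Definition U_obj (v : U_var) : R := if v is None then #|V|%:R else 0.

Definition uniform_pseudoflow (T : V -> {set V}) : linprog R :=
  @LP R U_var (U_con T) true (@U_mat T) (@U_rhs T) U_obj predT pred0.

Section RowLemmas.
Variables (S T : V -> {set V}).

Lemma sum_eq_mulr (X : finType) (a : X) (x : X -> R) :
  \sum_v (v == a)%:R * x v = x a.
Proof.
rewrite (bigD1 a) //= eqxx mul1r big1 ?addr0 // => v /negbTE ->.
by rewrite mul0r.
Qed.

Lemma N_row_zero p (x : N_var -> R) :
  \sum_v N_mat (inl (inl p) : N_con S) v * x v = x (inr (val p)).
Proof.
rewrite big_sumType /= big1 ?add0r => [|v _]; last by rewrite mul0r.
by rewrite (sum_eq_mulr _ (fun q => x (inr q))).
Qed.

Lemma N_row_norm (x : N_var -> R) :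
  \sum_v N_mat (inl (inr tt) : N_con S) v * x v
  = \sum_i \sum_(j in S i) x (inr (i, j)).
Proof.
rewrite big_sumType /= big1 ?add0r => [|v _]; last by rewrite mul0r.
rewrite pair_big_dep /= [RHS]big_mkcond /=; apply: eq_bigr => -[i j] _ /=.
by case: ifP => _; rewrite ?mul1r ?mul0r.
Qed.

Lemma N_row_edge e k (x : N_var -> R) :
  \sum_v N_mat (inr (e, k) : N_con S) v * x v
  = x (inl (e, k)) + (x (inr (esrc e, k)) - x (inr (etgt e, k))).
Proof.
rewrite big_sumType /= (sum_eq_mulr _ (fun q => x (inl q))); congr (_ + _).
under eq_bigr do rewrite mulrBl.
by rewrite sumrB !(sum_eq_mulr _ (fun q => x (inr q))).
Qed.

Lemma abs_N_row_edge e k (x : N_var -> R) :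
  \sum_v abs_N_mat (inr (e, k) : N_con S + edge * V) v * x v
  = x (inl (e, k)) + (x (inr (etgt e, k)) - x (inr (esrc e, k))).
Proof.
rewrite big_sumType /= (sum_eq_mulr _ (fun q => x (inl q))); congr (_ + _).
under eq_bigr do rewrite mulrBl.
by rewrite sumrB !(sum_eq_mulr _ (fun q => x (inr q))).
Qed.

Lemma big_option_type (X : finType) (F : option X -> R) :
  \sum_v F v = F None + \sum_a F (Some a).
Proof.
rewrite (bigD1 None) //=; congr (_ + _).
rewrite (reindex_omap Some id) /=; last by case.
by apply: eq_bigl => a; rewrite eqxx.
Qed.

Lemma U_row_le ek (y : U_var -> R) :
  \sum_v U_mat (inl (inl ek) : U_con T) v * y v = y (Some ek).
Proof.
by rewrite big_option_type /= mul0r add0r (sum_eq_mulr _ (fun q => y (Some q))).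
Qed.

Lemma U_row_ge ek (y : U_var -> R) :
  \sum_v U_mat (inl (inr ek) : U_con T) v * y v = - y (Some ek).
Proof.
rewrite big_option_type /= mul0r add0r; under eq_bigr do rewrite mulNr.
by rewrite sumrN (sum_eq_mulr _ (fun q => y (Some q))).
Qed.

Lemma U_row_flow p (y : U_var -> R) :
  \sum_v U_mat (inr p : U_con T) v * y v
  = y None - (\sum_(e : edge | etgt e == (val p).2) y (Some (e, (val p).1))
              - \sum_(e : edge | esrc e == (val p).2) y (Some (e, (val p).1))).
Proof.
rewrite big_option_type /= mul1r; congr (_ + _).
rewrite opprB (eq_bigr (fun q : edge * V => (if q.2 == (val p).1 then
    (esrc q.1 == (val p).2)%:R - (etgt q.1 == (val p).2)%:R else 0)
    * y (Some (q.1, q.2)))); last by case.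
rewrite -(pair_bigA _ (fun e k => (if k == (val p).1 then
    (esrc e == (val p).2)%:R - (etgt e == (val p).2)%:R else 0)
    * y (Some (e, k)))) /=.
rewrite [in RHS]big_mkcond [X in _ = _ - X]big_mkcond -sumrB.
apply: eq_bigr => e _; rewrite (bigD1 (val p).1) //= eqxx big1 ?addr0.
  by do 2!case: ifP => _; rewrite ?mulrBl ?mul0r ?mul1r.
by move=> k /negbTE ->; rewrite mul0r.
Qed.

Lemma mean_propA_valueE (x : N_var -> R) :
  lp_value (x : lp_var (mean_propA S) -> R)
  = \sum_(e : edge) \sum_k x (inl (e, k)).
Proof.
rewrite /lp_value /= big_sumType /= [X in _ + X]big1 ?addr0 => [|v _].
  by rewrite pair_bigA; apply: eq_bigr => -[e k] _; rewrite mul1r.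
by rewrite mul0r.
Qed.

Lemma mean_propA_feasibleP (x : N_var -> R) :
  lp_feasible (x : lp_var (mean_propA S) -> R) <->
  [/\ forall i j, j \notin S i -> x (inr (i, j)) = 0,
      \sum_i \sum_(j in S i) x (inr (i, j)) = #|V|%:R,
      forall (e : edge) k,
        x (inr (etgt e, k)) - x (inr (esrc e, k)) <= x (inl (e, k))
    & forall v, 0 <= x v].
Proof.
split=> [[rows pos] | [x0 x1 xc pos]].
  split=> [i j ij | | e k | v]; last exact: pos.
  - by have := rows (inl (inl (exist _ (i, j) ij))); rewrite /lp_row N_row_zero.
  - by have := rows (inl (inr tt)); rewrite /lp_row N_row_norm.
  - have := rows (inr (e, k)); rewrite /lp_row N_row_edge /=.
    by rewrite -[_ - x (inr (etgt _, _))]opprB subr_ge0.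
split=> [|v _]; last exact: pos.
case=> [[[[i j] ij] | []] | [e k]]; rewrite /lp_row.
- by rewrite N_row_zero; apply: x0.
- by rewrite N_row_norm.
- by rewrite N_row_edge /= -[_ - x (inr (etgt _, _))]opprB subr_ge0.
Qed.

Lemma abs_mean_propA_feasibleP (x : N_var -> R) :
  lp_feasible (x : lp_var (abs_mean_propA S) -> R) <->
  lp_feasible (x : lp_var (mean_propA S) -> R) /\
  forall (e : edge) k,
    x (inr (esrc e, k)) - x (inr (etgt e, k)) <= x (inl (e, k)).
Proof.
split=> [[rows pos] | [[rows pos] xc]].
  split=> [|e k].
    split=> [r|v v0]; last exact: pos.
    by have := rows (inl r); case: r => [[]|].
  have := rows (inr (e, k)); rewrite /lp_row abs_N_row_edge /=.
  by rewrite -[_ - x (inr (esrc _, _))]opprB subr_ge0.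
split=> [[r|[e k]]|v v0]; last exact: pos.
  by have := rows r; case: r => [[]|].
by rewrite /lp_row abs_N_row_edge /= -[_ - x (inr (esrc _, _))]opprB subr_ge0.
Qed.

Lemma uniform_pseudoflow_valueE (y : U_var -> R) :
  lp_value (y : lp_var (uniform_pseudoflow T) -> R) = #|V|%:R * y None.
Proof.
rewrite /lp_value big_option_type /= big1 ?addr0 // => v _.
by rewrite mul0r.
Qed.

Lemma uniform_pseudoflow_feasibleP (y : U_var -> R) :
  lp_feasible (y : lp_var (uniform_pseudoflow T) -> R) <->
  [/\ forall (e : edge) k, y (Some (e, k)) <= #|E|%:R^-1,
      forall (e : edge) k, - y (Some (e, k)) <= #|E|%:R^-1
    & forall k i, i \in T k ->
        y None <= \sum_(e : edge | etgt e == i) y (Some (e, k))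
                  - \sum_(e : edge | esrc e == i) y (Some (e, k))].
Proof.
split=> [[rows _] | [yl yg yf]].
  split=> [e k | e k | k i ki].
  - by have := rows (inl (inl (e, k))); rewrite /lp_row U_row_le.
  - by have := rows (inl (inr (e, k))); rewrite /lp_row U_row_ge.
  - have := rows (inr (exist _ (k, i) ki)); rewrite /lp_row U_row_flow /=.
    by rewrite subr_le0.
split=> [|v //]; case=> [[[e k]|[e k]] | [[k i] ki]]; rewrite /lp_row.
- by rewrite U_row_le; apply: yl.
- by rewrite U_row_ge; apply: yg.
- by rewrite U_row_flow /= subr_le0; apply: yf.
Qed.

End RowLemmas.

End Graph.

(* Main.v *)
Require Import Defs.
From mathcomp Require Import all_boot all_order all_algebra.
From mathcomp Require Import ring lra.
Import Order.TTheory GRing.Theory Num.Theory.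
Local Open Scope ring_scope.

(** Transposing the constraint matrix of the absolute-value program gives, for
    each edge-vertex pair [q], two nonnegative multipliers [w q] and [w' q]
    with [w q + w' q <= 1 / |E|], and a multiplier of the normalization which
    plays the role of [eta].  The multipliers enter the remaining rows only
    through [phi = w - w'], and those rows say that the net inflow of [phi] is
    at least [eta] on the scale.  A number [phi] has the form [w - w'] with such
    [w], [w'] exactly when [|phi| <= 1 / |E|], so this is the pseudo-flow
    program.  The free multipliers of the rows [n_(i, j) = 0] are only bounded
    above by a net inflow, hence can be projected away, and reinstated by
    choosing that inflow.

    In the one-sided program there is a single multiplier
    [0 <= w <= 2 / |E|], and [phi = w - 1 / |E|].  This shift is harmless
    precisely because a constant flow on a balanced graph has no net inflow.

    Conversely, the dual of the pseudo-flow program has multipliers [u], [v]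
    of the two capacity bounds and a density [t] on the scale, of total mass
    [|V|], with [u - v] the gradient of [t].  So [n] is [t] extended by zero,
    and [c = u + v] dominates the absolute value of the gradient; [u] and [v]
    are recovered as the half sum and half difference of [c] and the gradient.
    For the one-sided program, [c = u]: on a balanced graph a gradient sums to
    zero, so [u] and [v] have the same total and the objective
    [(1 / |E|) * sum (u + v)] equals [(2 / |E|) * sum c].

    All these maps are affine, and nowhere is [|E|] cancelled, so that the
    argument covers edgeless graphs, where [1 / |E|] is [0].  The four
    reductions are [dual_mean_reduces], [dual_U_reduces_mean],
    [dual_abs_mean_reduces] and [dual_U_reduces_abs_mean]. *)

(** * Affine functionals *)

Section Affine.
Set Implicit Arguments.
Unset Strict Implicit.
Variables (R : realFieldType) (X : finType).
Implicit Types h : (X -> R) -> R.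

Definition affine_fun h : Prop :=
  exists (m : X -> R) (b : R), forall x, h x = \sum_z m z * x z + b.

(** Reduces affinity of a map to its coordinates, so that the closure lemmas
    below suffice and no matrix ever has to be written down. *)
Lemma affine_mapP (Y : finType) (f : (X -> R) -> (Y -> R)) :
  (forall y, affine_fun (fun x => f x y)) -> affine_map f.
Proof. by move=> /fin_all_exists[M /fin_all_exists[b fE]]; exists M, b. Qed.

Lemma affine_ext h h' : h =1 h' -> affine_fun h -> affine_fun h'.
Proof. by move=> hh' [m [b hE]]; exists m, b => x; rewrite -hh'. Qed.

Lemma affine_coord a : affine_fun (fun x => x a).
Proof.
by exists (fun z => (z == a)%:R), 0 => x; rewrite sum_eq_mulr addr0.
Qed.

Lemma affine_cst c : affine_fun (fun=> c).
Proof.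
by exists (fun=> 0), c => x; rewrite big1 ?add0r // => z _; rewrite mul0r.
Qed.

Lemma affineD h h' :
  affine_fun h -> affine_fun h' -> affine_fun (fun x => h x + h' x).
Proof.
move=> [m [b hE]] [m' [b' hE']]; exists (fun z => m z + m' z), (b + b') => x.
rewrite hE hE' addrACA -big_split /=; congr (_ + _).
by apply: eq_bigr => z _; rewrite mulrDl.
Qed.

Lemma affineM h c : affine_fun h -> affine_fun (fun x => h x * c).
Proof.
move=> [m [b hE]]; exists (fun z => m z * c), (b * c) => x.
rewrite hE mulrDl mulr_suml; congr (_ + _).
by apply: eq_bigr => z _; rewrite mulrAC.
Qed.

Lemma affineB h h' :
  affine_fun h -> affine_fun h' -> affine_fun (fun x => h x - h' x).
Proof.
move=> hA hA'; apply: affine_ext (affineD hA (affineM (-1) hA')) => x.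
by rewrite mulrN1.
Qed.

Lemma affine_sum (I : Type) (r : seq I) (P : pred I) (F : I -> (X -> R) -> R) :
  (forall i, affine_fun (F i)) ->
  affine_fun (fun x => \sum_(i <- r | P i) F i x).
Proof.
move=> FA; elim: r => [|i r IHr].
  by apply: affine_ext (affine_cst 0) => x; rewrite big_nil.
case Pi: (P i).
  by apply: affine_ext (affineD (FA i) IHr) => x; rewrite big_cons Pi.
by apply: affine_ext IHr => x; rewrite big_cons Pi.
Qed.

End Affine.

(** * Extension by zero *)

Section ExtendByZero.
Set Implicit Arguments.
Unset Strict Implicit.
Variables (R : realFieldType) (X : finType) (P : pred X).
Implicit Type z : {q | P q} -> R.

Definition ext0 z (q : X) : R := oapp z 0 (insub q).

Lemma ext0_val z p : ext0 z (val p) = z p.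
Proof. by rewrite /ext0 valK. Qed.

Lemma ext0_out z q : ~~ P q -> ext0 z q = 0.
Proof. by move=> Pq; rewrite /ext0 insubN. Qed.

(** The form in which an extension by zero shows up in the columns of the
    constraint matrices. *)
Lemma ext0E z q : ext0 z q = \sum_p (q == val p)%:R * z p.
Proof.
have [Pq|Pq] := boolP (P q).
  have -> : q = val (exist _ q Pq : {q | P q}) by [].
  rewrite ext0_val -[LHS](sum_eq_mulr _ z).
  by apply: eq_bigr => p _; rewrite val_eqE eq_sym.
rewrite ext0_out // big1 // => p _.
case: eqP => [qE|_]; last by rewrite mul0r.
by move: Pq; rewrite qE (valP p).
Qed.

Lemma sum_ext0 z : \sum_q ext0 z q = \sum_p z p.
Proof.
under eq_bigr do rewrite ext0E.
rewrite exchange_big /=; apply: eq_bigr => p _.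
by rewrite (sum_eq_mulr _ (fun=> z p)).
Qed.

End ExtendByZero.

(** * Flows and potentials on a graph *)

Section Flows.
Set Implicit Arguments.
Unset Strict Implicit.
Variables (R : realFieldType) (V : finType) (E : {set V * V}).
Local Notation edge := (edge E).

Definition netflow (w : edge * V -> R) (i k : V) : R :=
  \sum_(e | etgt e == i) w (e, k) - \sum_(e | esrc e == i) w (e, k).

Definition gradient (n : V * V -> R) (q : edge * V) : R :=
  n (etgt q.1, q.2) - n (esrc q.1, q.2).

Lemma eq_gradient n n' : n =1 n' -> gradient n =1 gradient n'.
Proof. by move=> nn' q; rewrite /gradient !nn'. Qed.

Lemma sum_pair (X Y : finType) (F : X * Y -> R) :
  \sum_q F q = \sum_x \sum_y F (x, y).
Proof. by rewrite pair_bigA; apply: eq_bigr => -[]. Qed.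

Lemma netflowB w w' i k :
  netflow (fun q => w q - w' q) i k = netflow w i k - netflow w' i k.
Proof. by rewrite /netflow !sumrB; ring. Qed.

(** The net inflow as a single sum over edge-vertex pairs, the form produced
    by the column of [n_(i, k)]. *)
Lemma netflowE w i k :
  netflow w i k
  = \sum_q (((i, k) == (etgt q.1, q.2))%:R - ((i, k) == (esrc q.1, q.2))%:R)
           * w q.
Proof.
rewrite /netflow big_mkcond [X in _ - X]big_mkcond -sumrB.
rewrite sum_pair; apply: eq_bigr => e _.
rewrite (bigD1 k) //= big1 ?addr0 => [|l lk].
  rewrite !xpair_eqE eqxx !andbT !(eq_sym i).
  by do 2!case: eqP => _ /=; ring.
by rewrite !xpair_eqE (eq_sym k) (negbTE lk) !andbF subrr mul0r.
Qed.

Lemma affine_netflow (X : finType) (F : edge * V -> (X -> R) -> R) i k :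
  (forall q, affine_fun (F q)) ->
  affine_fun (fun x => netflow (fun q => F q x) i k).
Proof. by move=> FA; apply: affineB; apply: affine_sum. Qed.

Lemma card_in_edges i :
  #|[pred e : edge | etgt e == i]| = #|[set j | (j, i) \in E]|.
Proof.
rewrite -(card_in_imset (f := @esrc V E)) => [|e e'].
  apply: eq_card => j; rewrite inE; apply/imsetP/idP => [[e]|jiE].
    rewrite inE => /eqP <- ->; rewrite -surjective_pairing; exact: (valP e).
  by exists (exist _ (j, i) jiE); rewrite ?inE.
rewrite !inE => /eqP ei /eqP e'i ee'; apply: val_inj.
by rewrite /= [LHS]surjective_pairing [RHS]surjective_pairing; congr pair;
   rewrite // -/(etgt e) ei -e'i.
Qed.

Lemma card_out_edges i :
  #|[pred e : edge | esrc e == i]| = #|[set j | (i, j) \in E]|.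
Proof.
rewrite -(card_in_imset (f := @etgt V E)) => [|e e'].
  apply: eq_card => j; rewrite inE; apply/imsetP/idP => [[e]|ijE].
    rewrite inE => /eqP <- ->; rewrite -surjective_pairing; exact: (valP e).
  by exists (exist _ (i, j) ijE); rewrite ?inE.
rewrite !inE => /eqP ei /eqP e'i ee'; apply: val_inj.
by rewrite /= [LHS]surjective_pairing [RHS]surjective_pairing; congr pair;
   rewrite // -/(esrc e) ei -e'i.
Qed.

Lemma balanced_netflow_cst a i k :
  balanced E -> netflow (fun=> a) i k = 0.
Proof.
move=> Ebal; rewrite /netflow !sumr_const.
by rewrite card_in_edges card_out_edges Ebal subrr.
Qed.

(** The value of [n] at [i] is counted once for each incoming edge and minus
    once for each outgoing one, which is the net inflow at [i] of a constant
    flow. *)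
Lemma balanced_sum_gradient n :
  balanced E -> \sum_q gradient n q = 0.
Proof.
move=> Ebal; rewrite sum_pair exchange_big /=.
apply: big1 => k _; rewrite /gradient /= sumrB.
rewrite (partition_big (@etgt V E) predT) //=.
rewrite [X in _ - X](partition_big (@esrc V E) predT) //= -sumrB.
apply: big1 => i _.
apply: etrans (balanced_netflow_cst (n (i, k)) i k Ebal); rewrite /netflow.
by congr (_ - _); apply: eq_bigr => e /eqP ->.
Qed.

End Flows.

(** * The dual programs made explicit *)

Section Duals.
Set Implicit Arguments.
Unset Strict Implicit.
Variables (R : realFieldType) (V : finType) (E : {set V * V}).
Variable S : V -> {set V}.
Local Notation edge := (edge E).
Local Notation T := (dual_scale S).

Lemma N_col_c q (x : N_con E S -> R) :
  \sum_r N_mat R r (inl q) * x r = x (inr q).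
Proof.
rewrite !big_sumType /=.
do 2![rewrite big1 ?add0r; last by move=> *; rewrite mul0r].
under eq_bigr do rewrite eq_sym.
by rewrite (sum_eq_mulr _ (fun q => x (inr q))).
Qed.

Lemma N_col_n i k (x : N_con E S -> R) :
  \sum_r N_mat R r (inr (i, k)) * x r
  = ext0 (fun p => x (inl (inl p))) (i, k)
    + (k \in S i)%:R * x (inl (inr tt)) - netflow (fun q => x (inr q)) i k.
Proof.
rewrite !big_sumType /= ext0E netflowE -sumrN; congr (_ + _ + _).
  by rewrite (big_pred1 tt) // => -[].
by apply: eq_bigr => q _; rewrite -mulNr opprB.
Qed.

Lemma dual_mean_feasibleP (x : N_con E S -> R) a :
  lp_feasible (P := lp_dual (lp_scale a (mean_propA E R S))) x <->
  [/\ forall q, x (inr q) <= a,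
      forall i k, k \in S i ->
        x (inl (inr tt)) <= netflow (fun q => x (inr q)) i k,
      forall p, x (inl (inl p))
                <= netflow (fun q => x (inr q)) (val p).1 (val p).2
    & forall q, 0 <= x (inr q)].
Proof.
split=> [[rows pos] | [xa xl xz pos]].
  split=> [q | i k ik | p | q]; last exact: (pos (inr q)).
  - by have := rows (inl q); rewrite /lp_row /= N_col_c mulr1.
  - have := rows (inr (i, k)); rewrite /lp_row /= N_col_n mulr0.
    by rewrite ext0_out /= ?negbK // ik add0r mul1r subr_le0.
  - have := rows (inr (val p)); rewrite /lp_row /= mulr0.
    rewrite [val p]surjective_pairing N_col_n -surjective_pairing ext0_val.
    by rewrite (negbTE (valP p)) mul0r addr0 subr_le0.
split=> [[q|[i k]] | [[p|[]]|q] //]; rewrite /lp_row /=.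
  by rewrite N_col_c mulr1.
rewrite N_col_n mulr0 subr_le0; have [ik|ik] := boolP (k \in S i).
  by rewrite ext0_out /= ?negbK // add0r mul1r xl.
rewrite mul0r addr0.
have := ext0_val (fun p => x (inl (inl p))) (exist _ (i, k) ik).
by move=> /= ->; apply: (xz (exist _ (i, k) ik)).
Qed.

(** The two edge rows of a pair have opposite coefficients on [n] and equal
    ones on [c]; so the columns are those of the one-sided program at the
    difference of the two multipliers, up to a correction on [c]. *)
Lemma dual_abs_col (x : N_con E S + edge * V -> R) v :
  \sum_r abs_N_mat R r v * x r
  = \sum_r N_mat R r v * (if r is inr q then x (inl r) - x (inr q)
                          else x (inl r))
    + if v is inl q then x (inr q) *+ 2 else 0.
Proof.
rewrite big_sumType /= !(big_sumType _ _ (fun r : N_con E S => _)) /=.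
rewrite -!addrA; congr (_ + _).
case: v => [q|v].
  under eq_bigr do rewrite eq_sym.
  under [X in _ + X = _]eq_bigr do rewrite eq_sym.
  under [X in _ = X + _]eq_bigr do rewrite eq_sym.
  rewrite (sum_eq_mulr _ (fun q => x (inl (inr q)))).
  rewrite (sum_eq_mulr _ (fun q => x (inr q))).
  by rewrite (sum_eq_mulr _ (fun q => x (inl (inr q)) - x (inr q))); ring.
by rewrite addr0 -big_split /=; apply: eq_bigr => q _; ring.
Qed.

Lemma dual_abs_feasibleP (x : N_con E S + edge * V -> R) a :
  let phi q := x (inl (inr q)) - x (inr q) in
  lp_feasible (P := lp_dual (lp_scale a (abs_mean_propA E R S))) x <->
  [/\ forall q, x (inl (inr q)) + x (inr q) <= a,
      forall i k, k \in S i -> x (inl (inl (inr tt))) <= netflow phi i k,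
      forall p, x (inl (inl (inl p))) <= netflow phi (val p).1 (val p).2
    & forall q, 0 <= x (inl (inr q)) /\ 0 <= x (inr q)].
Proof.
move=> phi; split=> [[rows pos] | [xa xl xz pos]].
  split=> [q | i k ik | p | q].
  - have := rows (inl q); rewrite /lp_row /= dual_abs_col N_col_c mulr1.
    by rewrite mulr2n addrA subrK.
  - have := rows (inr (i, k)).
    rewrite /lp_row /= dual_abs_col N_col_n addr0 mulr0.
    by rewrite ext0_out /= ?negbK // ik add0r mul1r subr_le0.
  - have := rows (inr (val p)); rewrite /lp_row /= dual_abs_col addr0 mulr0.
    rewrite [val p]surjective_pairing N_col_n -surjective_pairing ext0_val.
    by rewrite (negbTE (valP p)) mul0r addr0 subr_le0.
  - by split; [apply: (pos (inl (inr q))) | apply: (pos (inr q))].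
split=> [[q|[i k]] | [[[p|[]]|q]|q] //]; rewrite /lp_row /=.
- by rewrite dual_abs_col N_col_c mulr1 mulr2n addrA subrK.
- rewrite dual_abs_col N_col_n addr0 mulr0 subr_le0.
  have [ik|ik] := boolP (k \in S i).
    by rewrite ext0_out /= ?negbK // add0r mul1r xl.
  rewrite mul0r addr0.
  have := ext0_val (fun p => x (inl (inl (inl p)))) (exist _ (i, k) ik).
  by move=> /= ->; apply: (xz (exist _ (i, k) ik)).
- by move=> _; case: (pos q).
- by move=> _; case: (pos q).
Qed.

(** The multipliers of the flow rows read as a function on all pairs; the
    coordinates are swapped because these rows are indexed by the dual scale. *)
Definition dual_U_density (x : U_con E T -> R) (ik : V * V) : R :=
  ext0 (fun p => x (inr p)) (ik.2, ik.1).

Lemma U_col_eta (x : U_con E T -> R) :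
  \sum_r U_mat R r None * x r = \sum_p x (inr p).
Proof.
rewrite !big_sumType /=.
do 2![rewrite big1 ?add0r; last by move=> *; rewrite mul0r].
by under eq_bigr do rewrite mul1r.
Qed.

Lemma U_col_phi q (x : U_con E T -> R) :
  \sum_r U_mat R r (Some q) * x r
  = x (inl (inl q)) - x (inl (inr q)) - gradient (dual_U_density x) q.
Proof.
case: q => e k; rewrite !big_sumType /=; congr (_ + _ + _).
- under eq_bigr do rewrite eq_sym.
  by rewrite (sum_eq_mulr _ (fun q => x (inl (inl q)))).
- under eq_bigr do rewrite eq_sym mulNr.
  by rewrite sumrN (sum_eq_mulr _ (fun q => x (inl (inr q)))).
rewrite /gradient /dual_U_density /= !ext0E opprB -sumrB.
apply: eq_bigr => -[[k' i'] ki'] _ /=; rewrite -mulrBl !xpair_eqE /=.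
congr (_ * _).
by case: (k == _); rewrite ?subrr.
Qed.

Lemma dual_U_feasibleP (x : U_con E T -> R) :
  lp_feasible (P := lp_dual (uniform_pseudoflow E R T)) x <->
  [/\ \sum_p x (inr p) = #|V|%:R,
      forall q, x (inl (inl q)) - x (inl (inr q))
                = gradient (dual_U_density x) q
    & forall r, 0 <= x r].
Proof.
split=> [[rows pos] | [x1 xg pos]].
  split=> [|q|r]; last exact: pos.
    by have := rows None; rewrite /lp_row /= U_col_eta.
  have := rows (Some q); rewrite /lp_row /= U_col_phi => /eqP.
  by rewrite subr_eq0 => /eqP.
split=> [[q|] | v _]; last exact: pos; rewrite /lp_row /=.
  by rewrite U_col_phi xg subrr.
by rewrite U_col_eta.
Qed.

Lemma dual_N_valueE (x : N_con E S -> R) :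
  \sum_r N_rhs R r * x r = #|V|%:R * x (inl (inr tt)).
Proof.
rewrite !big_sumType /= big1 ?add0r; last by move=> *; rewrite mul0r.
rewrite [X in _ + X]big1 ?addr0; last by move=> *; rewrite mul0r.
by rewrite (big_pred1 tt) // => -[].
Qed.

Lemma dual_U_valueE (x : U_con E T -> R) :
  lp_value (P := lp_dual (uniform_pseudoflow E R T)) x
  = #|E|%:R^-1 * \sum_q (x (inl (inl q)) + x (inl (inr q))).
Proof.
rewrite /lp_value /= !big_sumType /= [X in _ + X]big1 ?addr0.
  by rewrite -!mulr_sumr -mulrDr -big_split.
by move=> *; rewrite mul0r.
Qed.

Lemma scaled_mean_valueE (x : N_var E -> R) a :
  lp_value (P := lp_scale a (mean_propA E R S)) x
  = a * \sum_q x (inl q).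
Proof.
rewrite sum_pair -(mean_propA_valueE S) mulr_sumr.
by apply: eq_bigr => v _; rewrite mulrA.
Qed.

Lemma scaled_abs_mean_valueE (x : N_var E -> R) a :
  lp_value (P := lp_scale a (abs_mean_propA E R S)) x
  = a * \sum_q x (inl q).
Proof. exact: scaled_mean_valueE. Qed.

Lemma uniform_pseudoflow_netflowP (y : U_var E -> R) :
  lp_feasible (P := uniform_pseudoflow E R T) y <->
  (forall q, - #|E|%:R^-1 <= y (Some q) <= #|E|%:R^-1) /\
  (forall i k, k \in S i -> y None <= netflow (fun q => y (Some q)) i k).
Proof.
split=> [/uniform_pseudoflow_feasibleP[yl yg yf] | [yb yf]].
  split=> [[e k] | i k ik]; first by rewrite lerNl yl yg.
  by apply: yf; rewrite inE.
apply/uniform_pseudoflow_feasibleP; split=> [e k | e k | k i].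
- by have /andP[] := yb (e, k).
- by have /andP[] := yb (e, k); rewrite lerNl.
- by rewrite inE; apply: yf.
Qed.

Lemma gradientE (n : V * V -> R) (e : edge) k :
  gradient n (e, k) = n (etgt e, k) - n (esrc e, k).
Proof. by []. Qed.

Lemma mean_gradientP (x : N_var E -> R) a :
  lp_feasible (P := lp_scale a (mean_propA E R S)) x <->
  [/\ forall i j, j \notin S i -> x (inr (i, j)) = 0,
      \sum_i \sum_(j in S i) x (inr (i, j)) = #|V|%:R,
      forall q, gradient (fun p => x (inr p)) q <= x (inl q)
    & forall v, 0 <= x v].
Proof.
split=> [/mean_propA_feasibleP[x0 x1 xc pos] | [x0 x1 xc pos]].
  by split=> // -[e k]; apply: xc.
by apply/mean_propA_feasibleP; split=> // e k; apply: (xc (e, k)).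
Qed.

Lemma abs_mean_gradientP (x : N_var E -> R) a :
  lp_feasible (P := lp_scale a (abs_mean_propA E R S)) x <->
  [/\ forall i j, j \notin S i -> x (inr (i, j)) = 0,
      \sum_i \sum_(j in S i) x (inr (i, j)) = #|V|%:R,
      forall q, `|gradient (fun p => x (inr p)) q| <= x (inl q)
    & forall v, 0 <= x v].
Proof.
split=> [/abs_mean_propA_feasibleP[/(mean_gradientP _ a)[x0 x1 xc pos] xc'] |
         [x0 x1 xc pos]].
  split=> // -[e k]; rewrite ler_norml xc andbT lerNl gradientE opprB.
  exact: xc'.
apply/abs_mean_propA_feasibleP; split=> [|e k].
  apply/(mean_gradientP _ a); split=> // q.
  by have := xc q; rewrite ler_norml; case/andP.
have := xc (e, k); rewrite ler_norml lerNl gradientE opprB.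
by case/andP.
Qed.

Lemma dual_U_density_mass (x : U_con E T -> R) :
  \sum_i \sum_(k in S i) dual_U_density x (i, k) = \sum_p x (inr p).
Proof.
rewrite -[RHS](sum_ext0 (fun p => x (inr p))) sum_pair exchange_big /=.
apply: eq_bigr => i _; rewrite big_mkcond /=; apply: eq_bigr => k _.
case: ifP => // /negbT ik; rewrite ext0_out //= inE //.
Qed.

Lemma dual_U_density_ge0 (x : U_con E T -> R) p :
  (forall r, 0 <= x r) -> 0 <= dual_U_density x p.
Proof. by move=> pos; rewrite /dual_U_density /ext0; case: insub => /=. Qed.

Lemma dual_U_density_out (x : U_con E T -> R) i k :
  k \notin S i -> dual_U_density x (i, k) = 0.
Proof. by move=> ik; rewrite /dual_U_density ext0_out //= inE. Qed.

Lemma affine_dual_U_density p :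
  affine_fun (fun x : U_con E T -> R => dual_U_density x p).
Proof.
rewrite /dual_U_density /ext0; case: insub => [q|] /=.
  exact: affine_coord.
exact: affine_cst.
Qed.

Lemma dual_U_density_restrict (x : U_con E T -> R) (n : V * V -> R) :
  (forall i k, k \notin S i -> n (i, k) = 0) ->
  (forall p, x (inr p) = n ((val p).2, (val p).1)) ->
  dual_U_density x =1 n.
Proof.
move=> n0 xn [i k]; have [ik|ik] := boolP (k \in S i); last first.
  by rewrite dual_U_density_out // n0.
have ki : (k, i).2 \in T (k, i).1 by rewrite inE.
by rewrite /dual_U_density (ext0_val _ (exist _ (k, i) ki)) xn.
Qed.

(** Shifting the multipliers by [1 / |E|] turns [0 <= w <= 2 / |E|] into the
    symmetric capacity bounds; balancedness keeps the net inflow unchanged. *)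
Lemma dual_mean_reduces : balanced E ->
  lp_reduces (lp_dual (lp_scale (2 / #|E|%:R) (mean_propA E R S)))
             (uniform_pseudoflow E R T).
Proof.
move=> Ebal; split=> //; set a := #|E|%:R^-1 : R.
have netflow_shift (w : edge * V -> R) c i k :
    netflow (fun q => w q - c) i k = netflow w i k.
  by rewrite netflowB (balanced_netflow_cst c) // subr0.
exists (fun x v => match v : U_var E with
                   | None => x (inl (inr tt))
                   | Some q => x (inr q) - a
                   end),
       (fun y r => match r : N_con E S with
                   | inl (inl p) =>
                       netflow (fun q => y (Some q)) (val p).1 (val p).2
                   | inl (inr _) => y None
                   (* a difference, so that the shift lemma applies to it *)
                   | inr q => y (Some q) - (- a)
                   end); split.
- split; apply: affine_mapP.
    case=> [q|]; last exact: affine_coord.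
    by apply: affineB (affine_coord _ _) (affine_cst _ _).
  case=> [[p|[]]|q]; last 2 first.
  + exact: affine_coord.
  + by apply: affineB (affine_coord _ _) (affine_cst _ _).
  by apply: affine_netflow => q; apply: affine_coord.
- move=> x /dual_mean_feasibleP[xa xl _ pos]; split.
    apply/uniform_pseudoflow_netflowP; split=> [q | i k ik].
      by have := xa q; have := pos q; rewrite -/a; lra.
    by rewrite netflow_shift; apply: xl.
  by rewrite uniform_pseudoflow_valueE /lp_value /= dual_N_valueE.
- move=> y /uniform_pseudoflow_netflowP[yb yf]; split.
    apply/dual_mean_feasibleP; split=> [q | i k ik | p | q].
    + by have := yb q; rewrite -/a; lra.
    + by rewrite netflow_shift; apply: yf.
    + by rewrite netflow_shift.
    + by have := yb q; rewrite -/a; lra.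
  by rewrite uniform_pseudoflow_valueE /lp_value /= dual_N_valueE.
- by move=> y _ [q|] //=; rewrite opprK addrK.
Qed.

(** A flow bounded by [a = 1 / |E|] splits canonically as the difference of
    [(a + phi) / 2] and [(a - phi) / 2], which are nonnegative of sum [a]. *)
Lemma dual_abs_mean_reduces :
  lp_reduces (lp_dual (lp_scale #|E|%:R^-1 (abs_mean_propA E R S)))
             (uniform_pseudoflow E R T).
Proof.
split=> //; set a := #|E|%:R^-1 : R.
have abs_valueE (x : N_con E S + edge * V -> R) :
    lp_value (P := lp_dual (lp_scale a (abs_mean_propA E R S))) x
    = #|V|%:R * x (inl (inl (inr tt))).
  rewrite /lp_value /= big_sumType /= dual_N_valueE.
  by rewrite [X in _ + X]big1 ?addr0 // => q _; rewrite mul0r.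
exists (fun x v => match v : U_var E with
                   | None => x (inl (inl (inr tt)))
                   | Some q => x (inl (inr q)) - x (inr q)
                   end),
       (fun y r => match r : N_con E S + edge * V with
                   | inl (inl (inl p)) =>
                       netflow (fun q => y (Some q)) (val p).1 (val p).2
                   | inl (inl (inr _)) => y None
                   | inl (inr q) => (a + y (Some q)) * 2^-1
                   | inr q => (a - y (Some q)) * 2^-1
                   end).
have splitK (y : U_var E -> R) q :
    (a + y (Some q)) * 2^-1 - (a - y (Some q)) * 2^-1 = y (Some q).
  by field.
have netflow_split (y : U_var E -> R) i k :
    netflow (fun q => (a + y (Some q)) * 2^-1 - (a - y (Some q)) * 2^-1) i k
    = netflow (fun q => y (Some q)) i k.
  by congr (_ - _); apply: eq_bigr => e _; rewrite splitK.
split.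
- split; apply: affine_mapP.
    case=> [q|]; last exact: affine_coord.
    by apply: affineB; apply: affine_coord.
  case=> [[[p|[]]|q]|q].
  + by apply: affine_netflow => q; apply: affine_coord.
  + exact: affine_coord.
  + by apply/affineM/affineD; [apply: affine_cst | apply: affine_coord].
  + by apply/affineM/affineB; [apply: affine_cst | apply: affine_coord].
- move=> x /dual_abs_feasibleP[xa xl _ pos]; split.
    apply/uniform_pseudoflow_netflowP; split=> [q | i k ik].
      by have := xa q; have [] := pos q; rewrite -/a; lra.
    exact: xl.
  by rewrite uniform_pseudoflow_valueE abs_valueE.
- move=> y /uniform_pseudoflow_netflowP[yb yf]; split.
    apply/dual_abs_feasibleP; split=> [q | i k ik | p | q].
    + by lra.
    + by rewrite netflow_split; apply: yf.
    + by rewrite netflow_split.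
    + by have := yb q; rewrite -/a; split; lra.
  by rewrite uniform_pseudoflow_valueE abs_valueE.
- by move=> y _ [q|] //=; apply: splitK.
Qed.

(** With [c = u], the slack of [gradient n <= c] is [v]; the totals of [u] and
    [v] agree because the gradient sums to zero on a balanced graph. *)
Lemma dual_U_reduces_mean : balanced E ->
  lp_reduces (lp_dual (uniform_pseudoflow E R T))
             (lp_scale (2 / #|E|%:R) (mean_propA E R S)).
Proof.
move=> Ebal; split=> //.
exists (fun x v => match v : N_var E with
                   | inl q => x (inl (inl q))
                   | inr p => dual_U_density x p
                   end),
       (fun y r => match r : U_con E T with
                   | inl (inl q) => y (inl q)
                   | inl (inr q) => y (inl q) - gradient (fun p => y (inr p)) q
                   | inr p => y (inr ((val p).2, (val p).1))
                   end); split.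
- split; apply: affine_mapP.
    case=> [q|p]; [exact: affine_coord | exact: affine_dual_U_density].
  case=> [[q|q]|p]; [exact: affine_coord | | exact: affine_coord].
  by apply: affineB (affineB _ _); apply: affine_coord.
- move=> x /dual_U_feasibleP[x1 xg pos]; split.
    apply/mean_gradientP; split=> [i j | | q | [q|p]] //.
    + exact: dual_U_density_out.
    + by rewrite dual_U_density_mass.
    + by rewrite -(xg q) gerBl.
    + exact: dual_U_density_ge0.
  rewrite scaled_mean_valueE dual_U_valueE mulrAC mulrC; congr (_ * _).
  have := balanced_sum_gradient (dual_U_density x) Ebal.
  under eq_bigr do rewrite -xg.
  by rewrite sumrB big_split /=; lra.
- move=> y /mean_gradientP[y0 y1 yc pos].
  set x := (fun r => _).
  have xE : dual_U_density x =1 (fun p => y (inr p)).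
    exact: dual_U_density_restrict.
  split.
    apply/dual_U_feasibleP; split=> [|q|[[q|q]|p]]; rewrite /x //=.
    + rewrite -y1; apply: etrans (esym (dual_U_density_mass x)) _.
      by apply: eq_bigr => i _; apply: eq_bigr => k _; rewrite xE.
    + by rewrite (eq_gradient xE); ring.
    + by rewrite subr_ge0.
  rewrite scaled_mean_valueE dual_U_valueE [RHS]mulrAC [RHS]mulrC.
  congr (_ * _).
  rewrite /x big_split sumrB balanced_sum_gradient //=; ring.
- move=> y /mean_gradientP[y0 _ _ _] [q|p] //=.
  exact: (dual_U_density_restrict (n := fun p => y (inr p))).
Qed.

(** With [c = u + v] and [gradient n = u - v], nonnegativity of [u] and [v] is
    [|gradient n| <= c]. *)
Lemma dual_U_reduces_abs_mean :
  lp_reduces (lp_dual (uniform_pseudoflow E R T))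
             (lp_scale #|E|%:R^-1 (abs_mean_propA E R S)).
Proof.
split=> //.
exists (fun x v => match v : N_var E with
                   | inl q => x (inl (inl q)) + x (inl (inr q))
                   | inr p => dual_U_density x p
                   end),
       (fun y r => match r : U_con E T with
                   | inl (inl q) =>
                       (y (inl q) + gradient (fun p => y (inr p)) q) * 2^-1
                   | inl (inr q) =>
                       (y (inl q) - gradient (fun p => y (inr p)) q) * 2^-1
                   | inr p => y (inr ((val p).2, (val p).1))
                   end); split.
- split; apply: affine_mapP.
    case=> [q|p]; last exact: affine_dual_U_density.
    by apply: affineD; apply: affine_coord.
  case=> [[q|q]|p]; last exact: affine_coord.
  + by apply/affineM/affineD/affineB; apply: affine_coord.
  + by apply/affineM/affineB/affineB; apply: affine_coord.
- move=> x /dual_U_feasibleP[x1 xg pos]; split.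
    apply/abs_mean_gradientP; split=> [i j | | q | [q|p]] //.
    + exact: dual_U_density_out.
    + by rewrite dual_U_density_mass.
    + rewrite -(xg q) ler_norml.
      by have := pos (inl (inl q)); have := pos (inl (inr q)); lra.
    + by rewrite addr_ge0.
    + exact: dual_U_density_ge0.
  by rewrite scaled_abs_mean_valueE dual_U_valueE.
- move=> y /abs_mean_gradientP[y0 y1 yc pos].
  set x := (fun r => _).
  have xE : dual_U_density x =1 (fun p => y (inr p)).
    exact: dual_U_density_restrict.
  split.
    apply/dual_U_feasibleP; split=> [|q|[[q|q]|p]]; rewrite /x //=.
    + rewrite -y1; apply: etrans (esym (dual_U_density_mass x)) _.
      by apply: eq_bigr => i _; apply: eq_bigr => k _; rewrite xE.
    + by rewrite (eq_gradient xE); field.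
    + by have := yc q; rewrite ler_norml; lra.
    + by have := yc q; rewrite ler_norml; lra.
  rewrite scaled_abs_mean_valueE dual_U_valueE; congr (_ * _).
  by apply: eq_bigr => q _; rewrite /x; field.
- move=> y /abs_mean_gradientP[y0 _ _ _] [q|p] /=; first by field.
  exact: (dual_U_density_restrict (n := fun p => y (inr p))).
Qed.

End Duals.

Theorem lemma7p5 (R : realFieldType) (V : finType) (E : {set V * V})
    (S : V -> {set V}) (hE : loopless E) :
  (balanced E ->
     lp_is_dual (lp_scale (2 / #|E|%:R) (mean_propA E R S))
                (uniform_pseudoflow E R (dual_scale S)))
  /\ lp_is_dual (lp_scale (#|E|%:R^-1) (abs_mean_propA E R S))
                (uniform_pseudoflow E R (dual_scale S)).
Proof.
split=> [Ebal|]; split.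
- exact: dual_mean_reduces.
- exact: dual_U_reduces_mean.
- exact: dual_abs_mean_reduces.
- exact: dual_U_reduces_abs_mean.
Qed.
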